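(* Let $d\ge2$, let $K$ be a field, let $H\in\mathcal N_d$ with extremal rays $\mathbf a_1,\dots,\mathbf a_d$, and let $R=K[H]$. For any $\mathbf b\ne0$ in $H$, the sequence $\mathbf x^{\mathbf b},\ \mathbf x^{\mathbf a_1}-\mathbf x^{\mathbf a_2},\ \dots,\ \mathbf x^{\mathbf a_1}-\mathbf x^{\mathbf a_d}$ is a regular sequence on $R$.
   Context: $\mathbb N=\{0,1,2,\dots\}$. An affine semigroup $H\subseteq\mathbb N^d$ is a finitely generated submonoid of $\mathbb N^d$; it is always assumed that the group generated by $H$ is $\mathbb Z^d$. Let $C\subseteq\mathbb R^d$ be the cone generated by $H$. $H$ is normal if $H=C\cap\mathbb Z^d$, and simplicial if $C$ has exactly $d$ extremal rays (one-dimensional faces). $\mathcal N_d$ is the class of normal simplicial affine semigroups in $\mathbb N^d$ generating $\mathbb Z^d$ as a group. For $H\in\mathcal N_d$, the extremal rays of $H$ are the primitive lattice vectors $\mathbf a_1,\dots,\mathbf a_d\in H$ lying on the extremal rays of $C$. $K[H]$ is the subalgebra of $K[x_1,\dots,x_d]$ spanned by the monomials $\mathbf x^{\mathbf h}$, $\mathbf h\in H$. *)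

(* Defs.v *)
From HB Require Import structures.
From mathcomp Require Import all_boot all_order all_algebra.
From mathcomp Require Import classical_sets functions cardinality reals.
From mathcomp Require Import mpoly.

Set Implicit Arguments.
Unset Strict Implicit.
Unset Printing Implicit Defensive.

Import GRing.Theory Num.Theory.
Local Open Scope classical_set_scope.
Local Open Scope ring_scope.

(* The exponent vectors 'X_{1..d} play the role of N^d.                       *)

Definition vec_of (A : pzSemiRingType) d (m : 'X_{1..d}) : 'rV[A]_d :=
  \row_i (m i)%:R.

Record affine_semigroup (d : nat) := AffineSemigroup {
  semigroup_set :> set 'X_{1..d};
  semigroup0 : semigroup_set 0%MM;
  semigroupD : forall m n, semigroup_set m -> semigroup_set n ->
    semigroup_set (m + n)%MM;
  semigroup_fg : exists (k : nat) (g : 'I_k -> 'X_{1..d}),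
    forall m, semigroup_set m <->
      exists c : 'I_k -> nat, m = (\sum_(i < k) g i *+ c i)%MM;
  semigroup_group : forall z : 'rV[int]_d,
    exists (k : nat) (g : 'I_k -> 'X_{1..d}) (c : 'I_k -> int),
      (forall i, semigroup_set (g i)) /\
      z = \sum_(i < k) vec_of int (g i) *~ c i }.

Section Cones.
Variables (R : realType) (d : nat).
Implicit Types (S C F : set 'rV[R]_d) (H : affine_semigroup d).

Definition cone_generated S : set 'rV[R]_d :=
  [set v | exists (k : nat) (g : 'I_k -> 'rV[R]_d) (c : 'I_k -> R),
     [/\ forall i, S (g i), forall i, 0 <= c i & v = \sum_(i < k) c i *: g i]].

Definition semigroup_cone H : set 'rV[R]_d :=
  cone_generated [set vec_of R h | h in semigroup_set H].

(* A face is cut out by a linear form u that is nonnegative on C; u = 0 gives *)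
(* C itself.                                                                  *)
Definition is_face C F : Prop :=
  exists u : 'cV[R]_d, (forall v, C v -> 0 <= (v *m u) 0 0) /\
    F = [set v | C v /\ (v *m u) 0 0 = 0].

(* The linear span of F has dimension n.                                      *)
Definition has_dim F (n : nat) : Prop :=
  exists B : 'M[R]_(n, d),
    [/\ row_free B, forall i, F (row i B) & forall v, F v -> (v <= B)%MS].

Definition extremal_rays_of C : set (set 'rV[R]_d) :=
  [set F | is_face C F /\ has_dim F 1].

Definition normal H : Prop := forall z : 'rV[int]_d,
  (exists2 h, semigroup_set H h & z = vec_of int h) <->
  semigroup_cone H (map_mx intr z).

Definition simplicial H : Prop :=
  (extremal_rays_of (semigroup_cone H) #= `I_d)%card.

Definition normal_simplicial H : Prop := normal H /\ simplicial H.

Definition primitive (m : 'X_{1..d}) : Prop := (\big[gcdn/0]_(i < d) m i = 1)%N.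

(* The a_i enumerate, without repetition, the primitive lattice vectors on    *)
(* the extremal rays of the cone.                                             *)
Definition extremal_rays H (a : 'I_d -> H) : Prop :=
  [/\ injective a,
      forall i, primitive (val (a i)),
      forall i, exists2 F, extremal_rays_of (semigroup_cone H) F &
        F (vec_of R (val (a i)))
    & forall F, extremal_rays_of (semigroup_cone H) F ->
        exists i, F (vec_of R (val (a i)))].

End Cones.

Section SemigroupRing.
Variables (K : fieldType) (d : nat) (H : affine_semigroup d).

(* The K-span of the monomials 'X_[h] with h in H.                            *)
Definition semigroup_ring_pred : {pred {mpoly K[d]}} :=
  fun p => all (fun m => m \in semigroup_set H) (msupp p).

Lemma semigroup_ring_predP (p : {mpoly K[d]}) :
  reflect (forall m, m \in msupp p -> semigroup_set H m)
          (p \in semigroup_ring_pred).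
Proof.
by apply: (iffP allP) => sub m /sub; [move/set_mem | move/mem_set].
Qed.

Lemma semigroup_ring_subalg : subalg_closed semigroup_ring_pred.
Proof.
split=> [|c p q /semigroup_ring_predP Hp /semigroup_ring_predP Hq|
          p q /semigroup_ring_predP Hp /semigroup_ring_predP Hq].
- by apply/semigroup_ring_predP => m; rewrite msupp1 inE => /eqP ->;
    exact: semigroup0.
- apply/semigroup_ring_predP => m /msuppD_le; rewrite mem_cat.
  by case/orP => [/msuppZ_le|]; [exact: Hp | exact: Hq].
- apply/semigroup_ring_predP => m /msuppM_le /allpairsP [[m1 m2] /= [m1p m2q ->]].
  exact: semigroupD (Hp _ m1p) (Hq _ m2q).
Qed.

HB.instance Definition _ :=
  GRing.isSubalgClosed.Build K {mpoly K[d]} semigroup_ring_pred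
    semigroup_ring_subalg.

Record semigroup_ring := SemigroupRing {
  semigroup_ring_val :> {mpoly K[d]};
  _ : semigroup_ring_val \in semigroup_ring_pred }.

HB.instance Definition _ := [isSub for semigroup_ring_val].
HB.instance Definition _ := [Choice of semigroup_ring by <:].
HB.instance Definition _ := [SubChoice_isSubComNzRing of semigroup_ring by <:].
HB.instance Definition _ := [SubZmodule_isSubLmodule of semigroup_ring by <:].
HB.instance Definition _ :=
  [SubNzRing_SubLmodule_isSubLalgebra of semigroup_ring by <:].
HB.instance Definition _ := [SubLalgebra_isSubAlgebra of semigroup_ring by <:].

Lemma semigroup_monomial_subproof (h : H) :
  'X_[K, val h] \in semigroup_ring_pred.
Proof.
by apply/semigroup_ring_predP => m /mem_msuppXP <-; exact: set_mem (valP h).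
Qed.

Definition semigroup_monomial (h : H) : semigroup_ring :=
  SemigroupRing (semigroup_monomial_subproof h).

End SemigroupRing.

Definition ideal_generated (A : comNzRingType) (s : seq A) : set A :=
  [set x | exists c : 'I_(size s) -> A, x = \sum_i c i * s`_i].

Definition regular_sequence (A : comNzRingType) (s : seq A) : Prop :=
  (forall i, (i < size s)%N -> forall x,
     ideal_generated (take i s) (s`_i * x) -> ideal_generated (take i s) x) /\
  ~ ideal_generated s 1.

(* Main.v *)
(* The cone of [H] is pointed and spans R^d, and a minimal generating set of a  *)
(* pointed cone consists of generators of extremal rays; hence the [a_i] form a *)
(* basis of R^d, and by normality [H] is the set of lattice vectors whose       *)
(* coordinates in this basis are nonnegative.                                   *)
(*   Let I_k be the ideal of x^b, x^{a_0} - x^{a_1}, ..., x^{a_0} - x^{a_{k-1}} *)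
(* (indices start at 0) and call two vectors congruent if they differ by an     *)
(* element of the group spanned by the a_0 - a_j, 0 < j < k. The quotient by    *)
(* I_k has a basis indexed by the congruence classes of [H] that [b + H] does   *)
(* not meet, so f is in I_k iff the sum of its coefficients over each such      *)
(* class vanishes. If x^{a_0} - x^{a_k} maps f into I_k, a nonzero class sum    *)
(* of f at such a class would propagate along a_0 - a_k in both directions,     *)
(* until nonnegativity of the coordinates stops it at classes which, once       *)
(* shifted by a_0 (by a_k in the other direction), meet [b + H]. The two        *)
(* failures concern complementary sets of coordinates, a contradiction.         *)

(* The geometry enters only through the matrix [L] of [ray_coordinates], which passes to coordinates
   in the basis of the [a_i]; it rests on [semigroup_cone_rays], hence on Gordan's alternative. The
   algebra rests on the class sums: [ideal_class_sum] and [class_sum_ideal] identify membership in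
   I_k with the vanishing of the class sums at the classes missed by [b + H], and by
   [class_sum_ray_diff] multiplication by x^{a_0} - x^{a_k} becomes a difference of two shifted
   class sums. [class_sum_walk] is the propagation in one direction, and [regular_step] plays two
   opposite walks against each other. The first term is regular because K[H] is a domain; the ideal
   is proper because the class of 0 is missed by [b + H] ([unit_notin_ideal]). *)
Require Import Defs.
From mathcomp Require Import all_boot all_order all_algebra.
From mathcomp Require Import classical_sets functions cardinality reals.
From mathcomp Require Import mpoly.
From mathcomp Require Import boolp ring lra.
Import Order.TTheory Num.Theory.
Import GRing.Theory.
Local Open Scope ring_scope.

Set Implicit Arguments.
Unset Strict Implicit.
Unset Printing Implicit Defensive.

(** * Finitely generated pointed cones *)

Section Cones.
Variables (R : realType) (d : nat).
Implicit Types (S : set 'rV[R]_d) (s t : seq 'rV[R]_d) (u : 'cV[R]_d).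
Implicit Types (P : 'rV[R]_d -> Prop).

Lemma cone_ind S P : P 0 -> (forall x y, P x -> P y -> P (x + y)) ->
  (forall c x, 0 <= c -> S x -> P (c *: x)) ->
  forall v, cone_generated S v -> P v.
Proof.
move=> P0 PD PZ v [k [g [c [Sg c0 ->]]]].
by apply: big_ind => // i _; apply: PZ.
Qed.

Lemma cone0 S : cone_generated S 0.
Proof.
exists 0%N, (fun=> 0), (fun=> 0).
by split=> [[]|[]|] //; rewrite big_ord0.
Qed.

Lemma coneD S x y :
  cone_generated S x -> cone_generated S y -> cone_generated S (x + y).
Proof.
move=> [k1 [g1 [c1 [Sg1 c10 ->]]]] [k2 [g2 [c2 [Sg2 c20 ->]]]].
exists (k1 + k2)%N,
  (fun i => match fintype.split i with inl j => g1 j | inr j => g2 j end),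
  (fun i => match fintype.split i with inl j => c1 j | inr j => c2 j end).
split=> [i|i|]; try by case: (fintype.split i).
rewrite big_split_ord; congr (_ + _); apply: eq_bigr => i _ /=.
  by rewrite (unsplitK (inl i)).
by rewrite (unsplitK (inr i)).
Qed.

Lemma coneZ S c x : 0 <= c -> cone_generated S x -> cone_generated S (c *: x).
Proof.
move=> c0 [k [g [e [Sg e0 ->]]]]; exists k, g, (fun i => c * e i).
split=> // [i|]; first exact: mulr_ge0.
by rewrite scaler_sumr; apply: eq_bigr => i _; rewrite scalerA.
Qed.

Lemma mem_cone S x : S x -> cone_generated S x.
Proof.
move=> Sx; exists 1%N, (fun=> x), (fun=> 1).
by split=> //; rewrite big_ord1 scale1r.
Qed.

Lemma cone_sub S T : (forall x, S x -> cone_generated T x) ->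
  forall x, cone_generated S x -> cone_generated T x.
Proof.
move=> ST; apply: cone_ind => [|x y|c x c0 /ST]; [exact: cone0| |exact: coneZ].
exact: coneD.
Qed.

Definition seq_cone s := cone_generated (fun x => x \in s).

Lemma cone_map s (f : {linear 'rV[R]_d -> 'rV[R]_d}) v :
  seq_cone (map f s) v -> exists2 w, seq_cone s w & v = f w.
Proof.
move: v; apply: cone_ind.
- by exists 0; rewrite ?linear0 //; apply: cone0.
- move=> _ _ [x sx ->] [y sy ->]; exists (x + y); last by rewrite linearD.
  exact: coneD.
- move=> c _ c0 /mapP[x xs ->]; exists (c *: x); last by rewrite linearZ.
  by apply: coneZ => //; apply: mem_cone.
Qed.

Definition linform u (v : 'rV[R]_d) : R := (v *m u) 0 0.

Lemma linformD u x y : linform u (x + y) = linform u x + linform u y.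
Proof. by rewrite /linform mulmxDl mxE. Qed.

Lemma linformZ u c x : linform u (c *: x) = c * linform u x.
Proof. by rewrite /linform -scalemxAl mxE. Qed.

Lemma linform0 u : linform u 0 = 0.
Proof. by rewrite /linform mul0mx mxE. Qed.

Lemma linformDu u1 u2 x : linform (u1 + u2) x = linform u1 x + linform u2 x.
Proof. by rewrite /linform mulmxDr mxE. Qed.

Lemma linformZu u c x : linform (c *: u) x = c * linform u x.
Proof. by rewrite /linform -scalemxAr mxE. Qed.

Lemma linform_tr_gt0 x : x != 0 -> 0 < linform x^T x.
Proof.
move=> x0; rewrite /linform mxE.
have ge0 i : 0 <= x 0 i * x^T i 0 by rewrite mxE -expr2 sqr_ge0.
rewrite lt0r sumr_ge0 // andbT psumr_eq0 //.
apply: contraNN x0 => /allP x0; apply/eqP/rowP => i.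
have := x0 i (mem_index_enum _); rewrite !mxE -expr2 sqrf_eq0.
by move/eqP.
Qed.

Lemma linform_perturb s u q : (forall x, x \in s -> 0 < linform u x) ->
  exists2 e, 0 < e & forall x, x \in s -> 0 < linform (u + e *: q) x.
Proof.
elim: s => [|y s IH] us; first by exists 1.
have [|e e0 He] := IH; first by move=> x xs; apply: us; rewrite inE xs orbT.
have uy : 0 < linform u y by apply: us; rewrite inE eqxx.
(* The summand 1 keeps the denominator positive; halving [e'] below makes the inequality at [y]
   strict. *)
pose e' := linform u y / (1 + `|linform q y|).
have den0 : 0 < 1 + `|linform q y| by rewrite ltr_pwDl.
have e'0 : 0 < e' by rewrite divr_gt0.
(* The value at [z] is affine in the size of the perturbation, so positivity at 0 and at [m] gives
   it in between. Hence the minimum of two admissible sizes is admissible for both [y] and the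
   tail. *)
have main (z : 'rV_d) m : 0 < linform u z -> 0 < m -> 0 < linform (u + m *: q) z ->
    forall n, 0 < n -> n <= m -> 0 < linform (u + n *: q) z.
  move=> uz m0 mz n n0 nm.
  have [qz|qz] := leP 0 (linform q z).
    by rewrite linformDu linformZu; apply: ltr_pwDl => //; rewrite mulr_ge0 // ltW.
  by apply: (lt_le_trans mz); rewrite !linformDu !linformZu lerD2l ler_wnM2r // ltW.
exists (Num.min e (e' / 2)); first by rewrite lt_min e0 divr_gt0.
have m0 : 0 < Num.min e (e' / 2) by rewrite lt_min e0 divr_gt0.
move=> x; rewrite inE => /orP[/eqP->|xs].
  apply: (main _ (e' / 2)) => //; rewrite ?divr_gt0 ?ge_min ?lexx ?orbT //.
  rewrite linformDu linformZu.
  have qle : - linform q y <= 1 + `|linform q y|.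
    by rewrite (le_trans (ler_norm _)) // normrN lerDr.
  have e'M : e' * (1 + `|linform q y|) = linform u y by rewrite divfK // gt_eqF.
  have : e' * - linform q y <= linform u y by rewrite -e'M ler_wpM2l // ltW.
  by clearbody e'; move: uy; rewrite mulrN; clear; lra.
apply: (main _ e) => //; rewrite ?ge_min ?lexx //.
  by apply: us; rewrite inE xs orbT.
exact: He.
Qed.

(* Gordan's alternative. When [u] is positive on the tail but negative on the   *)
(* head [w], projecting the tail along [w] onto the kernel of [u] reduces the   *)
(* number of vectors.                                                           *)
Lemma gordan s :
  (exists u, forall x, x \in s -> 0 < linform u x) \/
  (exists2 x, x \in s & seq_cone s (- x)).
Proof.
have [n] := ubnP (size s); elim: n s => // n IH [|w s] /=; first by left; exists 0.
rewrite ltnS => sn.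
have sub x : seq_cone s x -> seq_cone (w :: s) x.
  by apply: cone_sub => y ys; apply: mem_cone; rewrite inE ys orbT.
have finish u q : (forall x, x \in s -> 0 < linform u x) ->
    linform u w = 0 -> 0 < linform q w ->
    exists u, forall x, x \in w :: s -> 0 < linform u x.
  move=> us uw qw; have [e e0 He] := linform_perturb q us.
  exists (u + e *: q) => x; rewrite inE => /orP[/eqP->|]; last exact: He.
  by rewrite linformDu linformZu uw add0r mulr_gt0.
have [[u us]|[x xs cx]] := IH s sn; last first.
  by right; exists x; [rewrite inE xs orbT | exact: sub].
have [uw|uw|uw] := ltgtP (linform u w) 0; last 1 first.
- have [->|w0] := eqVneq w 0.
    by right; exists 0; rewrite ?inE ?eqxx // oppr0; apply: cone0.
  by left; apply: (finish u w^T) => //; apply: linform_tr_gt0.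
- pose k x := - (linform u x / linform u w).
  have k0 x : x \in s -> 0 <= k x.
    move=> xs; rewrite /k -mulrN -invrN.
    by apply: divr_ge0; rewrite ?oppr_ge0; apply: ltW; rewrite ?us.
  have kw x : x \in s -> seq_cone (w :: s) (k x *: w).
    by move=> xs; apply: coneZ (k0 x xs) _; apply: mem_cone; rewrite inE eqxx.
  have [|[v vs]|[_ /mapP[x xs ->]] cx] := IH [seq x + k x *: w | x <- s].
  + by rewrite size_map.
  (* The multiple of [u] makes the form vanish on [w]; its value at [x] is then that of [v] at the
     projection [x + k x *: w]. The form [- u], positive on [w], supplies the final tilt. *)
  + left; apply: (finish (v + (- (linform v w / linform u w)) *: u) (- u)).
    * move=> x xs; have := vs _ (map_f _ xs).
      rewrite linformD linformZ linformDu linformZu /k.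
      by have -> : - (linform u x / linform u w) * linform v w =
                   - (linform v w / linform u w) * linform u x by ring.
    * by rewrite linformDu linformZu mulNr divfK ?subrr // lt_eqF.
    * by rewrite -scaleN1r linformZu mulN1r oppr_gt0.
  + right; exists x; first by rewrite inE xs orbT.
    have -> : - x = - (x + k x *: w) + k x *: w by rewrite opprD subrK.
    apply: coneD; last exact: kw.
    apply: cone_sub cx => _ /mapP[y ys ->]; apply: coneD; last exact: kw.
    by apply: sub; apply: mem_cone.
- by left; exists u => x; rewrite inE => /orP[/eqP->|/us].
Qed.

(** A generator in the cone of the others is discarded until none is left. Filtering removes all its
    copies, so repetitions do no harm. *)
Lemma minimal_generators s : exists t,
  [/\ {subset t <= s}, forall x, x \in s -> seq_cone t x &
      forall x, x \in t -> ~ seq_cone (filter (predC1 x) t) x].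
Proof.
have [n] := ubnP (size s); elim: n s => // n IH s; rewrite ltnS => sn.
have [[x [xs cx]]|min] :=
    pselect (exists x, x \in s /\ seq_cone (filter (predC1 x) s) x); last first.
  exists s; split=> // [x xs|x xs cx]; first exact: mem_cone.
  by apply: min; exists x.
have [|t [ts gt mt]] := IH (filter (predC1 x) s).
  apply: leq_trans sn; rewrite size_filter -(count_predC (pred1 x) s).
  by rewrite -[ltnLHS]add0n ltn_add2r -has_count has_pred1.
exists t; split=> // [y /ts|y ys]; first by rewrite mem_filter => /andP[].
have sub z : seq_cone (filter (predC1 x) s) z -> seq_cone t z by apply: cone_sub.
have [->|yx] := eqVneq y x; first exact: sub.
by apply: gt; rewrite mem_filter /= yx.
Qed.

Definition nonneg (v : 'rV[R]_d) := forall j, 0 <= v 0 j.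

Lemma nonneg_cone S : (forall x, S x -> nonneg x) ->
  forall x, cone_generated S x -> nonneg x.
Proof.
move=> S0; apply: cone_ind => [j|x y x0 y0 j|c x c0 Sx j]; rewrite mxE //.
  exact: addr_ge0.
by apply: mulr_ge0 => //; apply: S0.
Qed.

(* Gordan's alternative is applied to the projections along [x] of the other    *)
(* generators; nonnegativity excludes its second case.                          *)
Lemma minimal_exposed t : (forall x, x \in t -> nonneg x) ->
  (forall x, x \in t -> ~ seq_cone (filter (predC1 x) t) x) ->
  forall x, x \in t -> x != 0 /\ exists2 u, linform u x = 0 &
    forall v, seq_cone t v -> 0 < linform u v \/ exists2 c, 0 <= c & v = c *: x.
Proof.
move=> t0 mt x xt; pose t' := filter (predC1 x) t.
have nz y : y \in t -> y != 0.
  by move=> yt; apply: contra_not_neq (mt y yt) => ->; apply: cone0.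
split; first exact: nz.
have t'0 y : seq_cone t' y -> nonneg y.
  by apply: nonneg_cone => z; rewrite mem_filter => /andP[_ /t0].
have [i xi] : exists i, 0 < x 0 i.
  have /rV0Pn[i xi] := nz x xt.
  by exists i; rewrite lt0r xi t0.
(* Up to the factor [x 0 i], the projection along [x] onto the vectors with vanishing coordinate
   [i]. *)
pose M : 'M[R]_d := (x 0 i)%:M - delta_mx i 0 *m x.
have ME v : v *m M = x 0 i *: v - v 0 i *: x.
  rewrite mulmxBr mul_mx_scalar mulmxA -colE -(mul_scalar_mx (v 0 i)); congr (_ - _ *m _).
  by apply/matrixP=> j k; rewrite !ord1 !mxE eqxx.
have xM : x *m M = 0 by rewrite ME subrr.
have [[u us]|[_ /mapP[y yt ->]] cy] := gordan [seq v *m M | v <- t'].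
  have linformM v : linform (M *m u) v = linform u (v *m M) by rewrite /linform mulmxA.
  exists (M *m u); first by rewrite linformM xM linform0.
  apply: cone_ind => [|v w|c v c0 vt].
  - by right; exists 0; rewrite ?scale0r.
  - rewrite linformD => -[v0|[c c0 ->]] [w0|[e e0 ->]].
    + by left; apply: addr_gt0.
    + by left; rewrite !linformM -scalemxAl xM scaler0 linform0 addr0 -linformM.
    + by left; rewrite !linformM -scalemxAl xM scaler0 linform0 add0r -linformM.
    + by right; exists (c + e); rewrite ?addr_ge0 ?scalerDl.
  - have [->|vx] := eqVneq v x; first by right; exists c.
    have [->|cn0] := eqVneq c 0; first by right; exists 0; rewrite ?scale0r.
    left; rewrite linformZ mulr_gt0 //; first by rewrite lt0r cn0.
    by rewrite linformM; apply: us; apply: map_f; rewrite mem_filter /= vx.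
(* In the second case of the alternative, [y + e] lies in the cone of the other generators and on
   the line of [x]. Either it is 0, and nonnegativity gives [y = 0], or [x] is a positive multiple
   of it; both are excluded. *)
have [e ce yeM] := cone_map (f := mulmxr M) cy.
have cye : seq_cone t' (y + e) by apply: coneD ce; apply: mem_cone.
have /eqP := yeM; rewrite /= eq_sym -addr_eq0 addrC -mulmxDl ME subr_eq0 => /eqP ye.
have /predU1P[ye0|ye_gt0] : ((y + e) 0 i == 0) || (0 < (y + e) 0 i).
  by rewrite -le0r (t'0 _ cye).
- have /nz/negP[] : y \in t by move: yt; rewrite mem_filter => /andP[].
  move/eqP: ye; rewrite ye0 scale0r scaler_eq0 gt_eqF //= => /eqP ye.
  apply/eqP/rowP => j; move/rowP/(_ j): ye; rewrite !mxE => /eqP.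
  rewrite paddr_eq0; last exact: t'0.
    by case/andP => /eqP.
  by apply: t'0; apply: mem_cone.
- case: (mt x xt).
  have xE : (x 0 i / (y + e) 0 i) *: (y + e) = x.
    by rewrite mulrC -scalerA ye scalerA mulVf ?scale1r // gt_eqF.
  rewrite -[X in seq_cone _ X]xE.
  by apply: coneZ cye; apply: divr_ge0; apply: ltW.
Qed.
End Cones.

(** * Coordinates along the extremal rays *)

Section SemigroupCones.
Variables (R : realType) (d : nat) (H : affine_semigroup d).
Implicit Types (m h : 'X_{1..d}).

Lemma vec_of0 (A : pzSemiRingType) : vec_of A (0%MM : 'X_{1..d}) = 0.
Proof. by apply/rowP => i; rewrite !mxE mnm0E. Qed.

Lemma vec_ofD (A : pzSemiRingType) m h :
  vec_of A (m + h)%MM = vec_of A m + vec_of A h.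
Proof. by apply/rowP => i; rewrite !mxE mnmDE natrD. Qed.

Lemma vec_of_inj : injective (@vec_of R d).
Proof.
move=> m h /rowP mh; apply/mnmP => i.
by move: (mh i); rewrite !mxE => /eqP; rewrite eqr_nat => /eqP.
Qed.

Lemma map_vec_of m : map_mx intr (vec_of int m) = vec_of R m.
Proof. by apply/rowP => i; rewrite !mxE natz. Qed.

Lemma vec_of_nonneg m : nonneg (vec_of R m).
Proof. by move=> i; rewrite mxE ler0n. Qed.

Lemma vec_of_comb k (g : 'I_k -> 'X_{1..d}) (c : 'I_k -> nat) :
  vec_of R (\sum_(i < k) g i *+ c i)%MM = \sum_(i < k) (c i)%:R *: vec_of R (g i).
Proof.
apply/rowP => j; rewrite mxE mnm_sumE natr_sum summxE.
by apply: eq_bigr => i _; rewrite !mxE mulmnE natrM mulrC.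
Qed.

Variable (a : 'I_d -> H).
Hypothesis ha : extremal_rays R a.

Let ray i : 'rV[R]_d := vec_of R (val (a i)).

Lemma extremal_ray_neq0 i : ray i != 0.
Proof.
case: ha => _ /(_ i) pa _ _; apply/eqP => /rowP a0; move: pa.
rewrite /primitive big1 // => j _.
by move: (a0 j); rewrite !mxE => /eqP; rewrite pnatr_eq0 => /eqP.
Qed.

(** Each member of a minimal generating set spans a face cut out by its exposing form. This face is
    an extremal ray, so it contains some [ray i], of which the generator is a positive multiple. *)
Lemma semigroup_cone_rays (v : 'rV[R]_d) : semigroup_cone H v ->
  cone_generated (fun x => exists i, x = ray i) v.
Proof.
have [k [g gH]] := semigroup_fg H.
have Hg i : semigroup_set H (g i).
  apply/gH; exists (fun j => j == i : nat).
  rewrite (bigD1 i) //= eqxx mulm1n big1 ?addm0 // => j /negPf ->.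
  by rewrite mulm0n.
pose s := [seq vec_of R (g i) | i <- enum 'I_k].
have [t [ts st mt]] := minimal_generators s.
have Ct w : semigroup_cone H w -> seq_cone t w.
  apply: cone_sub => _ [h /gH[c ->] <-]; rewrite vec_of_comb.
  apply: big_ind => [||i _]; [exact: cone0|exact: coneD|].
  apply: coneZ; first exact: ler0n.
  by apply: st; apply: map_f; rewrite mem_enum.
have tg x : x \in t -> exists2 h, semigroup_set H h & vec_of R h = x.
  by move/ts/mapP => [i _ ->]; exists (g i).
have t0 x : x \in t -> nonneg x by move/tg => [h _ <-]; apply: vec_of_nonneg.
move/Ct; apply: cone_sub => x xt.
have [x0 [u ux ut]] := minimal_exposed t0 mt xt.
pose F : set 'rV[R]_d := fun w => semigroup_cone H w /\ (w *m u) 0 0 = 0.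
have Fx w : F w -> exists2 c, 0 <= c & w = c *: x.
  by case=> /Ct /ut [|//]; rewrite /linform => /lt0r_neq0/eqP.
have : extremal_rays_of (semigroup_cone H) F.
  split.
    exists u; split=> // w /Ct /ut [/ltW //|[c _ ->]].
    by rewrite -[_ 0 0]/(linform u _) linformZ ux mulr0.
  exists x; split.
  - by rewrite /row_free rank_rV x0.
  - move=> i; rewrite row_id; split=> //; apply: mem_cone.
    by have [h Hh <-] := tg x xt; exists h.
  - by move=> w /Fx[c _ ->]; apply: scalemx_sub.
case: ha => _ _ _ /[apply] -[i /Fx[c c0 ci]].
have cn0 : c != 0.
  by apply: contra_neq (extremal_ray_neq0 i) => c0'; rewrite /ray ci c0' scale0r.
have -> : x = c^-1 *: ray i by rewrite /ray ci scalerA mulVf // scale1r.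
by apply: coneZ; [rewrite invr_ge0|apply: mem_cone; exists i].
Qed.

(** [L] is the inverse of the matrix with rows [ray i]. The last property is where normality enters:
    lattice vectors with nonnegative coordinates lie in the cone, hence in [H]. *)
Lemma ray_coordinates : normal R H -> exists L : 'M[R]_d,
  [/\ L \in unitmx, forall i, ray i *m L = delta_mx 0 i,
      forall h, semigroup_set H h -> nonneg (vec_of R h *m L) &
      forall z : 'rV[int]_d, nonneg (map_mx intr z *m L) ->
        exists2 h, semigroup_set H h & z = vec_of int h].
Proof.
move=> hn; pose A := \matrix_i ray i.
have coef v : semigroup_cone H v -> exists2 c, nonneg c & v = c *m A.
  move/semigroup_cone_rays; move: v; apply: cone_ind.
  - by exists 0; [move=> j; rewrite mxE | rewrite mul0mx].
  - move=> _ _ [c c0 ->] [e e0 ->]; exists (c + e); last by rewrite mulmxDl.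
    by move=> j; rewrite mxE addr_ge0.
  - move=> c _ c0 [i ->]; exists (c *: delta_mx 0 i).
      by move=> j; rewrite !mxE mulr_ge0 // ler0n.
    by rewrite -scalemxAl -rowE rowK.
have inH h : semigroup_set H h -> semigroup_cone H (vec_of R h).
  by move=> Hh; apply: mem_cone; exists h.
(* The row space of [A] contains the cone, hence the group generated by [H], hence the standard
   basis. *)
have uA : A \in unitmx.
  rewrite -row_full_unit -sub1mx; apply/row_subP => j.
  have [k [g [c [Hg E]]]] := semigroup_group H (row j 1%:M).
  have -> : row j 1%:M = map_mx intr (row j 1%:M) :> 'rV[R]_d.
    by apply/rowP => i; rewrite !mxE; case: eqP.
  have -> : map_mx intr (row j 1%:M) = \sum_(i < k) (c i)%:~R *: vec_of R (g i).
    rewrite E; apply/rowP => l; rewrite mxE !summxE raddf_sum /=.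
    apply: eq_bigr => i _; rewrite -scaler_int !mxE.
    by rewrite intrM natz intz.
  apply: summx_sub => i _; apply: scalemx_sub.
  by have [e _ ->] := coef _ (inH _ (Hg i)); apply: submxMl.
exists (invmx A); split.
- by rewrite unitmx_inv.
- by move=> i; rewrite -[ray i](rowK ray) rowE mulmxK.
- by move=> h /inH/coef[c c0 ->]; rewrite mulmxK.
- move=> z zL; apply/hn.
  rewrite -[map_mx _ z](mulmxKV uA) mulmx_sum_row.
  apply: big_ind => [||i _]; [exact: cone0|exact: coneD|].
  by apply: coneZ => //; rewrite rowK; apply: inH; apply: set_mem (valP (a i)).
Qed.

End SemigroupCones.

(** * Congruence classes of exponents *)

Section Ideals.
Variables (A : comNzRingType) (s : seq A).

Lemma ideal_ind (P : A -> Prop) : P 0 -> (forall x y, P x -> P y -> P (x + y)) ->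
  (forall c x, x \in s -> P (c * x)) -> forall x, ideal_generated s x -> P x.
Proof.
move=> P0 PD PM x [c ->].
by apply: big_ind => // i _; apply: PM; apply: mem_nth.
Qed.

Lemma ideal0 : ideal_generated s 0.
Proof. by exists (fun=> 0); rewrite big1 // => i _; rewrite mul0r. Qed.

Lemma idealD x y :
  ideal_generated s x -> ideal_generated s y -> ideal_generated s (x + y).
Proof.
move=> [c ->] [e ->]; exists (fun i => c i + e i).
by rewrite -big_split; apply: eq_bigr => i _; rewrite /= mulrDl.
Qed.

Lemma idealM c x : ideal_generated s x -> ideal_generated s (c * x).
Proof.
move=> [e ->]; exists (fun i => c * e i).
by rewrite mulr_sumr; apply: eq_bigr => i _; rewrite mulrA.
Qed.

Lemma idealN x : ideal_generated s x -> ideal_generated s (- x).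
Proof. by rewrite -mulN1r; apply: idealM. Qed.

Lemma idealB x y :
  ideal_generated s x -> ideal_generated s y -> ideal_generated s (x - y).
Proof. by move=> sx sy; apply: idealD => //; apply: idealN. Qed.

Lemma mem_ideal x : x \in s -> ideal_generated s x.
Proof.
move=> xs; have xi : (index x s < size s)%N by rewrite index_mem.
exists (fun i => (i == Ordinal xi)%:R); rewrite (bigD1 (Ordinal xi)) //=.
rewrite eqxx mul1r nth_index // big1 ?addr0 // => i /negPf ->.
by rewrite mul0r.
Qed.

End Ideals.

Section ClassSums.
Variables (R : realType) (d : nat) (K : fieldType) (L : 'M[R]_d) (k : nat).
Implicit Types (v w z : 'rV[R]_d) (m : 'X_{1..d}) (f g : {mpoly K[d]}).

Definition coords m : 'rV[R]_d := vec_of R m *m L.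

Lemma coords0 : coords 0%MM = 0.
Proof. by rewrite /coords vec_of0 mul0mx. Qed.

Lemma coordsD m1 m2 : coords (m1 + m2)%MM = coords m1 + coords m2.
Proof. by rewrite /coords vec_ofD mulmxDl. Qed.

(* The group spanned by [e_0 - e_j] for [0 < j < k], where [e_0, ..., e_(d-1)]  *)
(* is the standard basis: the coordinate vectors of the [a_j].                  *)
Definition cong v : bool :=
  [&& [forall j, v 0 j \is a Num.int],
      [forall j : 'I_d, (k <= j)%N ==> (v 0 j == 0)] & \sum_j v 0 j == 0].

Lemma congP v : reflect
  [/\ forall j, v 0 j \is a Num.int, forall j : 'I_d, (k <= j)%N -> v 0 j = 0 &
      \sum_j v 0 j = 0] (cong v).
Proof.
apply: (iffP and3P) => [[/forallP ? /forallP v0 /eqP ?]|[? v0 ->]]; split=> //.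
- by move=> j kj; apply/eqP; move: (v0 j); rewrite kj.
- exact/forallP.
- by apply/forallP => j; apply/implyP => /v0/eqP.
Qed.

Lemma cong0 : cong 0.
Proof.
apply/congP; split=> [j|j _|]; rewrite ?mxE ?rpred0 //.
by rewrite big1 // => j _; rewrite mxE.
Qed.

Lemma congB v w : cong v -> cong w -> cong (v - w).
Proof.
move=> /congP[vi v0 vs] /congP[wi w0 ws]; apply/congP; split.
- by move=> j; rewrite !mxE rpredB.
- by move=> j kj; rewrite !mxE v0 ?w0 ?subr0.
- under eq_bigr do rewrite !mxE.
  by rewrite sumrB vs ws subr0.
Qed.

Lemma congD v w : cong v -> cong w -> cong (v + w).
Proof.
move=> cv cw; rewrite -[w]opprK; apply: congB => //.
by rewrite -sub0r congB ?cong0.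
Qed.

Lemma cong_addl v w : cong v -> cong (v + w) = cong w.
Proof.
move=> cv; apply/idP/idP => [cvw|]; last exact: congD.
by rewrite -(addKr v w) addrC congB.
Qed.

Lemma cong_delta (i j : 'I_d) : (i < k)%N -> (j < k)%N ->
  cong (delta_mx 0 i - delta_mx 0 j).
Proof.
move=> ik jk; apply/congP; split=> [l|l kl|].
- by rewrite !mxE rpredB // rpred_nat.
- rewrite !mxE !eqxx /= [l == i]gtn_eqF ?[l == j]gtn_eqF ?subrr //.
    exact: leq_trans jk kl.
  exact: leq_trans ik kl.
- under eq_bigr do rewrite !mxE !eqxx /=.
  have sum_delta (n : 'I_d) : \sum_l (l == n)%:R = 1 :> R.
    by rewrite (bigD1 n) //= eqxx big1 ?addr0 // => l /negPf->.
  by rewrite sumrB !sum_delta subrr.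
Qed.

(** The class is given by any real vector [z], so that it can be shifted freely, even to classes
    containing no exponent. *)
Definition class_sum f z : K := \sum_(m <- msupp f | cong (coords m - z)) f@_m.

(** Monomials of bounded degree form a common index set for several polynomials, which makes
    linearity a termwise matter. *)
Lemma class_sum_widen N f z : (msize f <= N)%N ->
  class_sum f z = \sum_(m : 'X_{1..d < N} | cong (coords m - z)) f@_m.
Proof.
move=> fN; rewrite [RHS](bigID (fun m : 'X_{1..d < N} => bmnm m \in msupp f)) /=.
rewrite [X in _ + X]big1 => [|m /andP[_]]; last by rewrite -mcoeff_eq0 => /eqP.
rewrite addr0 /class_sum -[LHS]big_filter -[RHS]big_filter.
rewrite -(big_map (@bmnm d N) xpredT (fun m => f@_m)).
apply: perm_big; apply: uniq_perm.
- by rewrite filter_uniq ?msupp_uniq.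
- rewrite map_inj_uniq ?filter_uniq ?index_enum_uniq //.
  exact: val_inj.
- move=> m; rewrite mem_filter; apply/andP/mapP => [[cm mf]|[n]].
    have mN : (mdeg m < N)%N by apply: leq_trans (msize_mdeg_lt mf) fN.
    by exists (BMultinom mN); rewrite // mem_filter /= cm mf mem_index_enum.
  by rewrite mem_filter => /andP[/andP[? ?] _] ->.
Qed.

Lemma class_sumB f g z : class_sum (f - g) z = class_sum f z - class_sum g z.
Proof.
pose N := maxn (msize (f - g)) (maxn (msize f) (msize g)).
rewrite !(@class_sum_widen N) ?leq_max ?leqnn ?orbT //.
by rewrite -sumrB; apply: eq_bigr => m _; rewrite mcoeffB.
Qed.

Lemma class_sum0 z : class_sum 0 z = 0.
Proof. by rewrite -(subrr (0 : {mpoly K[d]})) class_sumB subrr. Qed.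

Lemma class_sumD f g z : class_sum (f + g) z = class_sum f z + class_sum g z.
Proof.
have csN : class_sum (- g) z = - class_sum g z.
  by rewrite -[- g]sub0r class_sumB class_sum0 sub0r.
by rewrite -[X in f + X]opprK class_sumB csN opprK.
Qed.

Lemma class_sumZ c f z : class_sum (c *: f) z = c * class_sum f z.
Proof.
pose N := maxn (msize (c *: f)) (msize f).
rewrite !(@class_sum_widen N) ?leq_max ?leqnn ?orbT //.
by rewrite mulr_sumr; apply: eq_bigr => m _; rewrite mcoeffZ.
Qed.

Lemma class_sumX m z : class_sum 'X_[m] z = (cong (coords m - z))%:R.
Proof.
rewrite /class_sum msuppX big_cons big_nil mcoeffX eqxx addr0.
by case: ifP.
Qed.

Lemma class_sumMX f m z : class_sum (f * 'X_[m]) z = class_sum f (z - coords m).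
Proof.
rewrite /class_sum (perm_big _ (msuppMX f m)) big_map /=.
apply: eq_big => [n|n _]; last exact: mcoeffMX.
by rewrite coordsD opprB addrCA addrA.
Qed.

Lemma class_sum_cong f z w : cong (z - w) -> class_sum f z = class_sum f w.
Proof.
move=> zw; apply: eq_bigl => m.
by rewrite -[LHS](cong_addl _ zw) [_ + (_ - z)]addrC addrA subrK.
Qed.

Lemma class_sum_neq0 f z : class_sum f z != 0 ->
  exists2 m, m \in msupp f & cong (coords m - z).
Proof.
move=> fz; have [/hasP[m]|no] := boolP (has (fun m => cong (coords m - z)) (msupp f)).
  by exists m.
by move: fz; rewrite /class_sum big_hasC ?eqxx.
Qed.

End ClassSums.

(** * The semigroup ring *)

Section Monomials.
Variables (K : fieldType) (d : nat) (H : affine_semigroup d).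

(** Total in the exponent, with default value 0 outside [H], so that no membership proof is carried
    in terms. *)
Definition mono (h : 'X_{1..d}) : semigroup_ring K H := insubd 0 'X_[h].

Lemma val_mono h : semigroup_set H h -> \val (mono h) = 'X_[h].
Proof.
move=> Hh; rewrite insubdK //.
by apply/semigroup_ring_predP => m /mem_msuppXP <-.
Qed.

Lemma semigroup_monomialE (h : H) : semigroup_monomial K h = mono (val h).
Proof. by apply: val_inj; rewrite val_mono //; apply: set_mem (valP h). Qed.

Lemma monoD h1 h2 : semigroup_set H h1 -> semigroup_set H h2 ->
  mono (h1 + h2)%MM = mono h1 * mono h2.
Proof.
move=> H1 H2; apply: val_inj.
by rewrite rmorphM /= !val_mono ?mpolyXD //; apply: semigroupD.
Qed.

Lemma msupp_semigroup (f : semigroup_ring K H) m :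
  m \in msupp (\val f) -> semigroup_set H m.
Proof. by move: m; apply/semigroup_ring_predP; apply: valP. Qed.

Lemma semigroup_ring_mulf_eq0 (f g : semigroup_ring K H) :
  f * g = 0 -> f != 0 -> g = 0.
Proof.
move=> /(congr1 val); rewrite rmorphM /= => /eqP.
by rewrite mulf_eq0 => /orP[|] /eqP fg f0; [case/eqP: f0|]; apply: val_inj.
Qed.

Lemma val_scale c (f : semigroup_ring K H) : \val (c *: f) = c *: \val f.
Proof. exact: linearZ_LR. Qed.

End Monomials.

Section RowEntries.
Variables (A : pzRingType) (d : nat).
Implicit Types (v w : 'rV[A]_d).

Lemma rowDE v w j : (v + w) 0 j = v 0 j + w 0 j. Proof. exact: mxE. Qed.

Lemma rowNE v j : (- v) 0 j = - v 0 j. Proof. exact: mxE. Qed.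

Lemma rowZE c v j : (c *: v) 0 j = c * v 0 j. Proof. exact: mxE. Qed.

Lemma deltaE (i j : 'I_d) : (delta_mx 0 i : 'rV[A]_d) 0 j = (j == i)%:R.
Proof. by rewrite mxE eqxx. Qed.

(* Unlike [mxE], these leave the entries of a coordinate vector folded. *)
Definition entryE := (rowDE, rowNE, rowZE, deltaE).

End RowEntries.

(** * Regularity modulo the partial ideals *)

Section RegularSequence.
Variables (R : realType) (d : nat) (K : fieldType) (H : affine_semigroup d).
Variables (a : 'I_d -> H) (L : 'M[R]_d).
Hypothesis L_unit : L \in unitmx.
Hypothesis L_ray : forall i, vec_of R (val (a i)) *m L = delta_mx 0 i.
Hypothesis L_ge0 : forall h, semigroup_set H h -> nonneg (vec_of R h *m L).
Hypothesis L_lift : forall z : 'rV[int]_d, nonneg (map_mx intr z *m L) ->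
  exists2 h, semigroup_set H h & z = vec_of int h.

Local Notation lam := (coords L).

Lemma H_ray i : semigroup_set H (val (a i)).
Proof. exact: set_mem (valP (a i)). Qed.

Lemma coords_inj : injective lam.
Proof. by move=> m h /(can_inj (mulmxK L_unit))/vec_of_inj. Qed.

(** The [a_i] are lattice vectors, so an integral change of coordinates leads to a lattice vector;
    [L_lift] puts it in [H]. *)
Lemma coords_shift h (v : 'rV[R]_d) :
  (forall j, v 0 j \is a Num.int) -> nonneg (lam h + v) ->
  exists2 h', semigroup_set H h' & lam h' = lam h + v.
Proof.
move=> vi v0; pose n : 'rV[int]_d := map_mx Num.floor v.
have nv : map_mx intr n = v by apply/rowP => j; rewrite !mxE floorK.
pose z := vec_of int h + n *m (\matrix_i vec_of int (val (a i))).
have zE : map_mx intr z *m L = lam h + v.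
  rewrite map_mxD map_mxM nv map_vec_of mulmxDl -mulmxA; congr (_ + _).
  rewrite -[RHS]mulmx1; congr (_ *m _); apply/row_matrixP => i.
  rewrite row_mul -map_row rowK map_vec_of L_ray.
  by apply/rowP => j; rewrite !mxE eqxx eq_sym.
have [|h' Hh' zh'] := L_lift (z := z); first by rewrite zE.
by exists h' => //; rewrite -zE zh' map_vec_of.
Qed.

Variables (i0 : 'I_d) (k : nat) (b : 'X_{1..d}) (s : seq (semigroup_ring K H)).
Hypothesis i0E : i0 = 0%N :> nat.
Hypothesis k_gt0 : (0 < k)%N.
Hypothesis Hb : semigroup_set H b.
Local Notation X := (mono K H).
Local Notation e i := (delta_mx 0 i : 'rV[R]_d).
Local Notation y i := (mono K H (val (a i))).

(** [s] stands for the first [k] terms of the sequence; its members alone determine the ideal. *)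
Hypothesis mem_s : forall x, x \in s <->
  x = X b \/ exists2 j : 'I_d, (0 < j < k)%N & x = y i0 - y j.
Local Notation I := (ideal_generated s).

Let i0k : (i0 < k)%N. Proof. by rewrite i0E. Qed.

Let mu h : R := \sum_(j : 'I_d | (0 < j < k)%N) lam h 0 j.

(** One copy of [a_j] is traded for one of [a_0]; [mu] measures how much can still be traded. *)
Lemma mono_step h (j : 'I_d) : semigroup_set H h -> (0 < j < k)%N -> 1 <= lam h 0 j ->
  exists h', [/\ semigroup_set H h', lam h' = lam h + (e i0 - e j),
                 I (X h - X h') & mu h' = mu h - 1].
Proof.
move=> Hh j0k hj; have /andP[j0 jk] := j0k.
have ni0 (l : 'I_d) : (0 < l)%N -> (l == i0) = false.
  by move=> l0; apply/negbTE; apply: contraTneq l0 => ->; rewrite i0E.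
have [||h1 Hh1 h1E] := @coords_shift h (- e j).
- by move=> l; rewrite !entryE rpredN rpred_nat.
- move=> l; rewrite !entryE.
  have [->|lj] := eqVneq l j; first by rewrite subr_ge0.
  by rewrite subr0 L_ge0.
have hE : h = (h1 + val (a j))%MM.
  by apply: coords_inj; rewrite coordsD h1E /coords L_ray subrK.
have h'E : lam (h1 + val (a i0))%MM = lam h + (e i0 - e j).
  by rewrite coordsD h1E /coords L_ray -addrA [- _ + _]addrC.
exists (h1 + val (a i0))%MM; split=> //.
- by apply: semigroupD => //; apply: H_ray.
- rewrite hE !monoD //; try exact: H_ray.
  rewrite -mulrBr -[_ * _]opprK -mulrN opprB; apply/idealN/idealM/mem_ideal.
  by apply/mem_s; right; exists j.
- rewrite /mu h'E; under eq_bigr do rewrite rowDE.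
  rewrite big_split /=; congr (_ + _).
  rewrite (bigD1 j) //= big1 => [|l /andP[l0k lj]].
    by rewrite !entryE eqxx ni0 // mulr0n sub0r addr0.
  by rewrite !entryE (negPf lj) ni0 ?subrr //; case/andP: l0k.
Qed.

(** Both exponents are reduced by [mono_step], under an integer bound on the sum of their [mu],
    until their coordinates of index strictly between 0 and [k] are below 1. *)
Lemma mono_cong h h' : semigroup_set H h -> semigroup_set H h' ->
  cong k (lam h - lam h') -> I (X h - X h').
Proof.
have mu_ge0 m : semigroup_set H m -> 0 <= mu m.
  by move=> Hm; apply: sumr_ge0 => j _; apply: L_ge0.
move: (truncnS_gt (mu h + mu h')); move: (_.+1) => n.
elim: n h h' => [|n IH] h h' hn Hh Hh' hh'.
  by move: hn; rewrite ltNge addr_ge0 ?mu_ge0.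
have [[j j0k hj]|noh] := pselect (exists2 j : 'I_d, (0 < j < k)%N & 1 <= lam h 0 j).
  have [h1 [Hh1 h1E hh1 mu1]] := mono_step Hh j0k hj.
  rewrite -[X h](subrK (X h1)) -addrA; apply: idealD => //; apply: IH => //.
    by rewrite mu1 addrAC ltrBlDr -natr1 in hn *.
  rewrite h1E addrAC cong_addl //; apply: cong_delta => //.
  by case/andP: j0k.
have [[j j0k hj]|noh'] := pselect (exists2 j : 'I_d, (0 < j < k)%N & 1 <= lam h' 0 j).
  have [h1 [Hh1 h1E hh1 mu1]] := mono_step Hh' j0k hj.
  have -> : X h - X h' = X h - X h1 - (X h' - X h1).
    by rewrite opprB addrA subrK.
  apply: idealB => //; apply: IH => //.
    by rewrite mu1 addrA ltrBlDr -natr1 in hn *.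
  rewrite h1E opprD addrA addrC cong_addl // opprB; apply: cong_delta => //.
  by case/andP: j0k.
(* Reduced congruent exponents agree: coordinates in [0, 1) with integral difference are equal,
   those of index [>= k] agree by congruence, and the sum condition settles index 0. *)
suff -> : h = h' by rewrite subrr; apply: ideal0.
apply: coords_inj; apply/eqP; rewrite -subr_eq0; apply/eqP.
have /congP[vi v0 vs] := hh'.
have vj (j : 'I_d) : j != i0 -> (lam h - lam h') 0 j = 0.
  move=> ji0; have [kj|jk] := leqP k j; first exact: v0.
  have j0k : (0 < j < k)%N.
    by rewrite jk andbT lt0n; apply: contra_neq ji0 => j0; apply: val_inj; rewrite /= i0E.
  have hj : lam h 0 j < 1 by rewrite ltNge; apply/negP => hj; apply: noh; exists j.
  have h'j : lam h' 0 j < 1 by rewrite ltNge; apply/negP => h'j; apply: noh'; exists j.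
  have := L_ge0 Hh j; have := L_ge0 Hh' j; have /intrP[z zE] := vi j.
  rewrite zE; move: zE; rewrite !entryE => zE h'0 h0.
  have : (z < 1) && (-1 < z).
    by rewrite -(ltr_int R) -(ltr_int R) -zE; apply/andP; split; lra.
  by case: z {zE} => [[|[|?]]|[|?]].
apply/rowP => j; rewrite [RHS]mxE; have [->|] := eqVneq j i0; last exact: vj.
by rewrite -[RHS]vs (bigD1 i0) //= big1 ?addr0.
Qed.

Definition meets_b z := exists2 h, semigroup_set H h & cong k (lam h + lam b - z).

Lemma meets_b_cong z w : cong k (z - w) -> meets_b z -> meets_b w.
Proof.
move=> zw [h Hh hz]; exists h => //.
by rewrite -[_ + lam b](subrK z) -addrA congD.
Qed.

Lemma meets_b_ray z i : meets_b z -> meets_b (z + e i).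
Proof.
move=> [h Hh hz]; exists (h + val (a i))%MM.
  by apply: semigroupD => //; apply: H_ray.
by rewrite coordsD [coords L (val _)]L_ray addrAC opprD addrACA subrr addr0 addrAC.
Qed.

Local Notation csum f := (class_sum L k (\val f)).

Lemma class_sum_ray_diff (f : semigroup_ring K H) i j z :
  csum (f * (y i - y j)) z = csum f (z - e i) - csum f (z - e j).
Proof.
rewrite rmorphM raddfB /= !val_mono; try exact: H_ray.
by rewrite mulrBr class_sumB !class_sumMX /coords !L_ray.
Qed.

(** Multiples of x^b have their support in [b + H]; for a multiple of [y i0 - y j], the two shifted
    class sums are taken at congruent vectors and cancel. *)
Lemma ideal_class_sum (f : semigroup_ring K H) z : I f -> ~ meets_b z -> csum f z = 0.
Proof.
move=> If nz; move: f If; apply: ideal_ind.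
- by rewrite raddf0 class_sum0.
- by move=> f g f0 g0; rewrite raddfD class_sumD f0 g0 addr0.
- move=> c _ /mem_s[->|[j /andP[j0 jk] ->]].
    rewrite rmorphM /= val_mono // class_sumMX.
    apply/eqP; apply: contra_notT nz => /class_sum_neq0[m mc cm].
    exists m; first exact: msupp_semigroup mc.
    by move: cm; rewrite opprB addrA.
  rewrite class_sum_ray_diff; apply/eqP; rewrite subr_eq0; apply/eqP.
  by apply: class_sum_cong; rewrite opprB addrC addrA subrK cong_delta.
Qed.

(* Clears the support of [f] one monomial [X m] at a time: either [X m] lies in *)
(* the ideal, or the vanishing class sum provides another monomial of [f] to    *)
(* which [X m] is congruent modulo the ideal.                                   *)
Lemma class_sum_ideal (f : semigroup_ring K H) :
  (forall z, ~ meets_b z -> csum f z = 0) -> I f.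
Proof.
have [n] := ubnP (size (msupp (\val f))); elim: n f => // n IH f; rewrite ltnS => fn f0.
have [f_nil|[m mf]] : msupp (\val f) = [::] \/ exists m, m \in msupp (\val f).
  by case: (msupp _) => [|m t]; [left|right; exists m; rewrite inE eqxx].
  have -> : f = 0; last exact: ideal0.
  by apply: val_inj; apply/eqP; rewrite -msupp_eq0 f_nil.
have Hm := msupp_semigroup mf.
pose c := (\val f)@_m.
(* [g] is 0 if [b + H] meets the class of [m], and otherwise another monomial of [f] in that class.
   Subtracting [c *: (X m - g)] then removes [m] and adds no monomial. *)
suff [g [Ig gz gm gf]] : exists g, [/\ I (X m - g),
    forall z, ~ meets_b z -> csum g z = (cong k (lam m - z))%:R,
    (\val g)@_m = 0 & {subset msupp (\val g) <= msupp (\val f)}].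
  have -> : f = (f - c *: (X m - g)) + c *: (X m - g) by rewrite subrK.
  apply: idealD; last by rewrite -[X m - g]mul1r scalerAl; apply: idealM.
  have vE : \val (f - c *: (X m - g)) = \val f - c *: ('X_[m] - \val g).
    by rewrite -(val_mono K Hm) -raddfB -val_scale -raddfB.
  apply: IH => [|z nz]; last first.
    by rewrite vE class_sumB class_sumZ class_sumB class_sumX f0 ?gz // subrr mulr0 subrr.
  apply: leq_trans fn; rewrite vE.
  have <- : (size (filter (predC1 m) (msupp (\val f)))).+1 = size (msupp (\val f)).
    rewrite size_filter -(count_predC (pred1 m) (msupp _)).
    by rewrite count_uniq_mem ?msupp_uniq // mf add1n.
  rewrite ltnS; apply: uniq_leq_size => [|l]; first exact: msupp_uniq.
  rewrite mem_filter /= !mcoeff_msupp mcoeffB mcoeffZ mcoeffB mcoeffX => lf.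
  have lm : l != m.
    by apply: contraNneq lf => ->; rewrite eqxx gm subr0 mulr1 subrr.
  rewrite lm /=; move: lf; apply: contra_neq => lf.
  have lg : (\val g)@_l = 0.
    apply/eqP; rewrite mcoeff_eq0; apply: contraTN (introT eqP lf) => /gf.
    by rewrite mcoeff_msupp.
  by rewrite lf lg eq_sym (negPf lm) subr0 mulr0 subr0.
have [mb|nmb] := pselect (meets_b (lam m)).
  have v0 : \val (0 : semigroup_ring K H) = 0 by exact: raddf0.
  exists 0; split; rewrite ?v0.
  - rewrite subr0; have [h Hh hm] := mb.
    have -> : X m = X h * X b - (X (h + b)%MM - X m).
      by rewrite monoD // opprB addrC subrK.
    apply: idealB; first by apply/idealM/mem_ideal/mem_s; left.
    by apply: mono_cong => //; [apply: semigroupD | rewrite coordsD].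
  - move=> z nz; rewrite class_sum0; case: (boolP (cong _ _)) => // mz.
    by case: nz; apply: meets_b_cong mb.
  - exact: mcoeff0.
  - by rewrite msupp0.
(* If [m] were alone in its class, the class sum would be its nonzero coefficient. *)
have [m' m'f [mm' cmm']] : exists2 m', m' \in msupp (\val f) &
    m' != m /\ cong k (lam m' - lam m).
  have cs0 := f0 _ nmb; apply: contrapT => no; have := mf.
  rewrite mcoeff_msupp => /eqP; apply; move: cs0; rewrite /class_sum big_mkcond /=.
  rewrite (bigD1_seq m mf (msupp_uniq _)) /= subrr cong0 big1_seq ?addr0 // => l.
  case/andP => lm lf; case: ifP => // cl.
  by case: no; exists l.
exists (X m'); split.
- apply: mono_cong => //; first exact: msupp_semigroup m'f.
  by rewrite -opprB -sub0r congB ?cong0.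
- move=> z nz; rewrite val_mono ?class_sumX; last exact: msupp_semigroup m'f.
  by rewrite -[in RHS](cong_addl _ cmm') addrA subrK.
- by rewrite val_mono ?mcoeffX ?(negPf mm') //; apply: msupp_semigroup m'f.
- by move=> l; rewrite val_mono ?msuppX ?inE => [/eqP->//|]; apply: msupp_semigroup m'f.
Qed.

(** As long as [w + e p] is missed, so is [w + e p - e q], by [meets_b_ray], and it has the same
    class sum as [w]. Each step lowers [phi] by 1, while [phi] stays nonnegative, so the walk
    stops. *)
Lemma class_sum_walk (f : semigroup_ring K H) (p q : 'I_d) (phi : 'rV[R]_d -> R) z :
  (forall w, ~ meets_b w -> csum f (w - e p) = csum f (w - e q)) ->
  (forall n, phi (z + n%:R *: (e p - e q)) = phi z - n%:R) ->
  (forall w, csum f w != 0 -> 0 <= phi w) ->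
  ~ meets_b z -> csum f z != 0 ->
  exists n : nat, let w := z + n%:R *: (e p - e q) in
    [/\ ~ meets_b w, csum f w != 0 & meets_b (w + e p)].
Proof.
move=> fpq phiE phi0 nz fz; apply: contrapT => no.
have walk n : let w := z + n%:R *: (e p - e q) in ~ meets_b w /\ csum f w != 0.
  elim: n => [|n /= [nw fw]]; first by rewrite /= scale0r addr0.
  have nwp : ~ meets_b (z + n%:R *: (e p - e q) + e p).
    by move=> wp; apply: no; exists n.
  have -> : z + n.+1%:R *: (e p - e q) = z + n%:R *: (e p - e q) + e p - e q.
    by rewrite -natr1 scalerDl scale1r !addrA.
  by split; [move/(@meets_b_ray _ q); rewrite subrK | rewrite -fpq // addrK].
have [_ /phi0] := walk (Num.truncn (phi z)).+1.
by rewrite phiE subr_ge0 leNgt truncnS_gt.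
Qed.

(* Suppose a class [z] is missed by [b + H] but has a nonzero class sum of [f]. *)
(* Multiplication by [y i0 - y j] forces the nonvanishing to spread along       *)
(* [e i0 - e j], in both directions, until [b + H] is met after adding [e i0],  *)
(* respectively [e j]. The first meeting bounds the coordinates of index        *)
(* [>= k] of [z - b], the second one its other coordinates.                     *)
Lemma regular_step (f : semigroup_ring K H) (j : 'I_d) : j = k :> nat ->
  I ((y i0 - y j) * f) -> I f.
Proof.
move=> jk If; apply: class_sum_ideal => z nz.
have [//|fz] := eqVneq (csum f z) 0; exfalso.
have i0j : (i0 == j) = false.
  by apply/negbTE; rewrite -val_eqE /= i0E jk neq_ltn k_gt0.
have lj (l : 'I_d) : (l < k)%N -> (l == j) = false.
  by move=> lk; apply/negbTE; rewrite -val_eqE /= jk neq_ltn lk.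
have step w : ~ meets_b w -> csum f (w - e i0) = csum f (w - e j).
  move=> nw; apply/eqP; rewrite -subr_eq0 -class_sum_ray_diff mulrC.
  by rewrite ideal_class_sum.
(* Coordinate [j], of index [k], is constant on classes and nonnegative on [H], so it bounds this
   walk. *)
have [||n1 /= []] := class_sum_walk (phi := fun w => w 0 j) step _ _ nz fz.
- by move=> n; rewrite !entryE eqxx eq_sym i0j sub0r mulrN1.
- move=> w /class_sum_neq0[m /msupp_semigroup Hm /congP[_ m0 _]].
  by move: (m0 j); rewrite jk leqnn !entryE => /(_ isT)/subr0_eq <-; apply: L_ge0.
set w := _ + _ => nw fw [h Hh /congP[_ h0 _]].
(* The walk back starts at [w]. The sum of the coordinates of index [< k] bounds it, being constant
   on classes: a congruence changes no other coordinate and preserves the total. *)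
have [||| | |n2 /= [_ _]] := @class_sum_walk f j i0
    (fun v => \sum_(l : 'I_d | (l < k)%N) v 0 l) w; try by [].
- by move=> v /step.
- move=> n; under eq_bigr do rewrite rowDE.
  rewrite big_split /= [X in _ + X](bigD1 i0) //=.
  rewrite [X in _ + (_ + X)]big1 => [|l /andP[lk li0]].
    by rewrite !entryE eqxx i0j sub0r mulrN1 addr0.
  by rewrite !entryE (negPf li0) lj // subrr mulr0.
- move=> v /class_sum_neq0[m /msupp_semigroup Hm /congP[_ m0 ms]].
  suff <- : \sum_(l : 'I_d | (l < k)%N) lam m 0 l = \sum_(l : 'I_d | (l < k)%N) v 0 l.
    by apply: sumr_ge0 => l _; apply: L_ge0.
  apply/eqP; rewrite -subr_eq0 -sumrB -[X in _ == X]ms.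
  rewrite [X in _ == X](bigID (fun l : 'I_d => (l < k)%N)) /=.
  rewrite [X in _ == _ + X]big1 => [|l]; last by rewrite -leqNgt; apply: m0.
  by rewrite addr0; apply/eqP/eq_bigr => l _; rewrite !entryE.
set v := _ + _ => -[h' Hh' hv'].
(* Moving [h'] by [t] undoes the second walk, so [h' + t + b] is congruent to [w]. It remains to see
   that [h' + t] is nonnegative: at index [>= k] its coordinates are those of [h], and at index
   [< k] those of [t] are nonnegative. *)
pose t := - e j + n2%:R *: (e i0 - e j).
have ti l : t 0 l \is a Num.int.
  by rewrite !entryE; rewrite ?(rpredD, rpredN, rpredM, rpred_nat).
have tE : lam h' + lam b - v = lam h' + t + lam b - w.
  rewrite /t /v; apply/rowP => l; rewrite !entryE; ring.
have [|h2 Hh2 h2E] := coords_shift ti (h := h'); last first.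
  by apply: nw; exists h2; rewrite // h2E -tE.
have wt : cong k (lam h' + t + lam b - w) by rewrite -tE.
move=> l; have [kl|lk] := leqP k l.
  have li0 : (l == i0) = false.
    by apply/negbTE; rewrite -val_eqE /= i0E -lt0n (leq_trans k_gt0).
  have /congP[_ /(_ l kl) + _] := wt; have := h0 l kl; have := L_ge0 Hh l.
  rewrite !entryE li0 -/(lam h) mulr0n => hl; lra.
rewrite !entryE; apply: addr_ge0; first exact: L_ge0.
by rewrite lj // mulr0n oppr0 add0r addr0 mulr_ge0 ?ler0n.
Qed.

(** Congruent vectors have equal coordinate sums, and on [H] this sum vanishes only at 0. So [b + H]
    misses the class of 0, where the class sum of 1 is 1. *)
Lemma unit_notin_ideal : (forall j : 'I_d, (j < k)%N) -> b != 0%MM -> ~ I 1.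
Proof.
move=> dk b0 I1; have nz : ~ meets_b 0.
  move=> [h Hh /congP[_ _]]; rewrite subr0 -coordsD => hs; case/negP: b0.
  have Hhb : semigroup_set H (h + b)%MM by apply: semigroupD.
  have : lam (h + b)%MM = lam 0%MM.
    rewrite coords0; apply/rowP => j; rewrite [RHS]mxE.
    have /psumr_eq0P : forall l : 'I_d, true -> 0 <= lam (h + b)%MM 0 l.
      by move=> l _; apply: L_ge0.
    exact.
  move/coords_inj/eqP; rewrite mnmD_eq0 => /andP[_].
  by [].
have /eqP := ideal_class_sum I1 nz.
by rewrite rmorph1 -mpolyX0 class_sumX coords0 subrr cong0 oner_eq0.
Qed.

End RegularSequence.

Theorem proposition2p2 (R : realType) (d : nat) (hd : (2 <= d)%N)
  (K : fieldType) (H : affine_semigroup d) (hH : normal_simplicial R H)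
  (a : 'I_d -> H) (ha : extremal_rays R a)
  (b : H) (hb : val b != 0%MM) :
  regular_sequence
    (semigroup_monomial K b ::
     [seq semigroup_monomial K (a (Ordinal (ltnW hd))) - semigroup_monomial K (a i)
        | i : 'I_d <- enum 'I_d & (0 < i)%N]).
Proof.
have [L [L_unit L_ray L_ge0 L_lift]] := ray_coordinates ha (proj1 hH).
have Hb : semigroup_set H (val b) by apply: set_mem (valP b).
set i0 := Ordinal (ltnW hd); set y := fun i => semigroup_monomial K (a i).
set r := [seq i : 'I_d <- enum 'I_d | (0 < i)%N]; set S := _ :: _.
have valr : map val r = iota 1 d.-1.
  rewrite -filter_map val_enum_ord -[X in iota 0 X](ltn_predK hd) /=.
  by apply/all_filterP/allP => j; rewrite mem_iota => /andP[].
have sz_r : size r = d.-1 by rewrite -(size_map val) valr size_iota.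
(* Since x^b occupies position 0, the difference with [a_j] sits at position [j], and the first [k]
   terms involve exactly the indices [0 < j < k]. *)
have mem_take k : (0 < k)%N -> forall x, x \in take k S <->
    x = mono K H (val b) \/ exists2 j : 'I_d, (0 < j < k)%N &
      x = mono K H (val (a i0)) - mono K H (val (a j)).
  case: k => // k _ x; rewrite /= -map_take in_cons.
  have mem_r (j : 'I_d) : (j \in take k r) = (0 < j < k.+1)%N.
    rewrite -(mem_map val_inj) map_take valr take_iota mem_iota add1n ltnS leq_min.
    have -> : (j <= d.-1)%N by rewrite -ltnS (ltn_predK hd).
    by rewrite andbT.
  rewrite -!semigroup_monomialE; split.
    case/predU1P => [->|/mapP[j]]; first by left.
    rewrite mem_r => jk ->; right; exists j => //.
    by rewrite -semigroup_monomialE.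
  case=> [->|[j jk ->]]; first by rewrite eqxx.
  by apply/orP; right; apply/mapP; exists j; rewrite ?mem_r // -semigroup_monomialE.
split=> [[_ x|k]|].
(* The empty prefix generates the zero ideal, so the claim is that x^b is a nonzero element of a
   domain. *)
- rewrite take0 => -[c]; rewrite big_ord0 => bx0; exists c; rewrite big_ord0.
  apply: semigroup_ring_mulf_eq0 bx0 _; apply/eqP => /(congr1 val).
  rewrite -[S`_0]/(semigroup_monomial K b) => /(congr1 (mcoeff (val b))).
  rewrite semigroup_monomialE val_mono // mcoeffX eqxx !raddf0.
  by move/eqP; rewrite oner_eq0.
- rewrite [size S]/= ltnS size_map => kr x.
  have jk : nth i0 r k = k.+1 :> nat.
    by rewrite -(nth_map i0 0%N val) // valr nth_iota // -sz_r.
  have -> : S`_k.+1 = mono K H (val (a i0)) - mono K H (val (a (nth i0 r k))).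
    by rewrite /= (nth_map i0) // -!semigroup_monomialE.
  apply: (regular_step L_unit L_ray L_ge0 L_lift _ _ Hb _ jk) => //.
  exact: mem_take.
- rewrite -[S]take_size; 
  apply: (unit_notin_ideal L_unit L_ray L_ge0 _ _ Hb (mem_take _ _)) => //.
  by move=> j; rewrite /= size_map sz_r (ltn_predK hd).
Qed.
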